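(* Let $x,z$ be complex parameters with $x\neq 0$. For $|q|<|x|$ and $|zq|<1$ (and $|q|<1$), and for each positive integer $N$, $$[q^N]\sum_{n\geq0}\sum_{m\geq n}\left(\frac{zx^{n-m}q^{m+1}}{(1-zq^{m+1})(1-zq^{n+1})}-\frac{zx^{-m-1}q^{n+m+2}}{(1-q^{m+1})(1-zq^{n+1})}\right)=\sum_{d\mid N}d\,z^d.$$
   Context: $[q^N]F(q)$ denotes the coefficient of $q^N$ in the expansion of $F$ as a power series in $q$, where $x$ and $z$ are treated as constants independent of $q$. The sum $\sum_{d\mid N}$ runs over the positive divisors $d$ of $N$. *)

(* Defs.v *)
From Stdlib Require Import Reals ZArith List.
From Coquelicot Require Import Coquelicot.
Import ListNotations.

Open Scope C_scope.

(* Coquelicot only provides [Cpow] with exponents in [nat]; this is the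
   analogue of [powerRZ] on [C]. *)
Definition CpowZ (x : C) (k : Z) : C :=
  match k with
  | Z0 => 1
  | Zpos p => x ^ Pos.to_nat p
  | Zneg p => / x ^ Pos.to_nat p
  end.

Definition summand (x z q : C) (n m : nat) : C :=
  z * CpowZ x (Z.of_nat n - Z.of_nat m) * q ^ (m + 1)
    / ((1 - z * q ^ (m + 1)) * (1 - z * q ^ (n + 1)))
  - z * CpowZ x (- Z.of_nat m - 1) * q ^ (n + m + 2)
    / ((1 - q ^ (m + 1)) * (1 - z * q ^ (n + 1))).

Definition conv_disc (x z q : C) : Prop :=
  (Cmod q < Cmod x)%R /\ (Cmod (z * q) < 1)%R /\ (Cmod q < 1)%R.

(* [sum_{n >= 0} sum_{m >= n} u n m] converges, as an iterated series, to [s];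
   the inner index is [m = n + k] with [k >= 0]. *)
Definition is_double_sum (u : nat -> nat -> C) (s : C) : Prop :=
  exists v : nat -> C,
    (forall n : nat, is_series (fun k : nat => u n (n + k)%nat) (v n)) /\
    is_series v s.

Definition is_expansion (D : C -> Prop) (F : C -> C) (a : nat -> C) : Prop :=
  forall q : C, D q -> is_pseries a q (F q).

(* [q^N] F(q) = c, for a function [F] on an open disc [D] centred at 0. That
   the expansion exists is part of the assertion; ranging over every expansion
   makes the value [c] independent of the choice of one. *)
Definition is_coef (D : C -> Prop) (F : C -> C) (N : nat) (c : C) : Prop :=
  (exists a : nat -> C, is_expansion D F a) /\
  (forall a : nat -> C, is_expansion D F a -> a N = c).

(* The positive divisors of [N], for [N > 0]. *)
Definition divisors (N : nat) : list nat :=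
  filter (fun d => Nat.eqb (N mod d) 0) (seq 1 N).

Definition sum_over_divisors (N : nat) (f : nat -> C) : C :=
  fold_right Cplus 0 (map f (divisors N)).

(* Main.v *)
Require Import Defs.
From Stdlib Require Import Reals ZArith List Lia Lra.
From Coquelicot Require Import Coquelicot.

(** The diagonal [m = n] of the first part of the summand is
    [L = sum_n z q^(n+1) / (1 - z q^(n+1))^2], and everything else cancels.

    Put [w = q/x], so that [|w| < 1], and [g n = z q^(n+1) / (1 - z q^(n+1))].
    With [k = m - n] the first part of the summand is
    [w^k z q^(n+1) / ((1 - z q^(n+k+1)) (1 - z q^(n+1)))] and the second one is
    [w^(m+1) / (1 - q^(m+1)) * g n].  Both are dominated by a product of two
    geometric sequences, one in each index, so the order of summation may be
    exchanged ([double_series_exchange]) and both double sums can be grouped by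
    powers of [w].  For [j >= 1], partial fractions ([first_part_eq]) turn the
    coefficient of [w^j] in the first sum into
    [(1 - q^j)^-1 sum_n (g n - g (n + j))], which telescopes to
    [(1 - q^j)^-1 sum_(n < j) g n]; this is the coefficient of [w^j] in the
    second sum.  The difference of the two sums is the coefficient of [w^0] in
    the first, which is [L] ([double_sum_diagonal]).

    Expanding [t / (1 - t)^2 = sum_d d t^d] at [t = z q^(k+1)] and exchanging
    the sums over [k] and [d] gives [L = sum_d sum_k d z^d q^(d(k+1))]; a second
    exchange collects the terms with [d (k+1) = N], which is the power series
    with coefficients [sum_(d | N) d z^d] ([lambert_pseries]).

    Hence that power series represents the double sum on the whole disc.  Any
    other expansion has the same coefficients: on the real axis the real and
    imaginary parts are real power series, and these determine their
    coefficients ([pseries_coef_unique]). *)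

(** * Exchanging the summations of a dominated double series *)

Lemma is_series_eq {K : AbsRing} {V : NormedModule K} (a : nat -> V) (l l' : V) :
  is_series a l -> is_series a l' -> l = l'.
Proof. apply (filterlim_locally_unique (sum_n a)). Qed.

(** This form of the identity mentions the additive monoid of [V] along the same
    path as [sum_n] does in statements about [is_series], so that it can be used
    for rewriting there. *)
Lemma plus_minus_r {K : AbsRing} {V : NormedModule K} (x y : V) :
  @plus (NormedModule.AbelianMonoid K V) (minus x y) y = x.
Proof.
  exact (eq_trans (eq_sym (plus_assoc x (opp y) y))
           (eq_trans (f_equal (plus x) (plus_opp_l y)) (plus_zero_r x))).
Qed.

Lemma norm_is_series_le {K : AbsRing} {V : NormedModule K}
    (f : nat -> V) (b : nat -> R) (l : V) (beta : R) :
  (forall k, norm (f k) <= b k)%R -> is_series f l -> is_series b beta ->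
  (norm l <= beta)%R.
Proof.
  intros Hfb Hf Hb.
  apply (is_lim_seq_le (fun N => norm (sum_n f N)) (sum_n b) (norm l) beta).
  - intros N. eapply Rle_trans; [apply norm_sum_n_m |].
    now apply sum_n_m_le.
  - exact (filterlim_comp _ _ _ _ _ _ _ _ Hf (filterlim_norm l)).
  - exact Hb.
Qed.

Lemma norm_series_tail_le {K : AbsRing} {V : NormedModule K}
    (f : nat -> V) (b : nat -> R) (l : V) (beta : R) (N : nat) :
  (forall k, norm (f k) <= b k)%R -> is_series f l -> is_series b beta ->
  (norm (minus l (sum_n f N)) <= beta - sum_n b N)%R.
Proof.
  intros Hfb Hf Hb.
  apply (norm_is_series_le (fun k => f (S N + k)%nat) (fun k => b (S N + k)%nat)).
  - intros k. apply Hfb.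
  - apply is_series_incr_n; [lia |]. simpl pred.
    now rewrite plus_minus_r.
  - apply is_series_incr_n; [lia |]. simpl pred.
    exact (eq_ind_r (is_series b) Hb (plus_minus_r (V := R_NormedModule) beta _)).
Qed.

(** The error of the square partial sum with respect to the partial sum of the row
    sums is at most [sum_(n <= N) A n] times a tail of [B], which tends to 0. The
    statement is symmetric in the two indices up to exchanging [A] and [B]: this
    is what makes the square sums a common limit for both iterated sums. *)
Lemma square_sums_lim {K : AbsRing} {V : NormedModule K}
    (A B : nat -> R) (alpha beta : R) (u : nat -> nat -> V) (v : nat -> V) (s : V) :
  is_series A alpha -> is_series B beta ->
  (forall n k, norm (u n k) <= A n * B k)%R ->
  (forall n, is_series (u n) (v n)) -> is_series v s ->
  filterlim (fun N => sum_n (fun n => sum_n (u n) N) N) eventually (locally s).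
Proof.
  intros HA HB Hu Hv Hs.
  pose (e := (fun N => sum_n (fun n => minus (v n) (sum_n (u n) N)) N) : nat -> V).
  assert (He : filterlim e eventually (locally (zero : V))).
  { apply filterlim_norm_zero. change (is_lim_seq (fun N => norm (e N)) 0%R).
    apply (is_lim_seq_le_le (fun _ => 0%R) _ (fun N => sum_n A N * (beta - sum_n B N))%R).
    + intros N. split; [apply norm_ge_0 |].
      unfold e. eapply Rle_trans; [apply norm_sum_n_m |].
      eapply Rle_trans; [| exact (Req_le _ _ (sum_n_mult_r (K := R_Ring) _ A N))].
      apply sum_n_m_le. intros n.
      assert (HAB : is_series (fun k => A n * B k)%R (A n * beta)%R)
        by exact (is_series_scal (V := R_NormedModule) (A n) B beta HB).
      eapply Rle_trans; [exact (norm_series_tail_le (u n) _ _ _ N (Hu n) (Hv n) HAB) |].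
      assert (E : sum_n (fun k => A n * B k)%R N = (A n * sum_n B N)%R)
        by exact (sum_n_mult_l (K := R_Ring) (A n) B N).
      rewrite E. apply Req_le. unfold mult; simpl; ring.
    + apply is_lim_seq_const.
    + assert (H0 : is_lim_seq (fun N => sum_n A N * (beta - sum_n B N))%R
                     (alpha * (beta - beta))%R).
      { apply is_lim_seq_mult'; [exact HA |].
        apply is_lim_seq_minus'; [apply is_lim_seq_const | exact HB]. }
      replace (alpha * (beta - beta))%R with 0%R in H0 by ring. exact H0. }
  assert (Hlim : filterlim (fun N => plus (sum_n v N) (opp (e N)) : V) eventually
                   (locally (plus s (opp zero) : V))).
  { apply (filterlim_comp_2 (G := locally s) (H := locally (opp zero : V))
             (sum_n v) (fun N => opp (e N) : V) plus).
    - exact Hs.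
    - exact (filterlim_comp _ _ _ e opp _ _ _ He (filterlim_opp zero)).
    - apply filterlim_plus. }
  rewrite opp_zero, plus_zero_r in Hlim.
  refine (filterlim_ext _ _ _ Hlim). intros N.
  transitivity (plus (sum_n (fun n => plus (minus (v n) (sum_n (u n) N)) (sum_n (u n) N)) N)
                     (opp (e N)) : V).
  - f_equal. apply sum_n_ext. intros n. symmetry. apply plus_minus_r.
  - rewrite sum_n_plus, plus_comm, plus_assoc. unfold e.
    rewrite plus_opp_l. apply plus_zero_l.
Qed.

Lemma iterated_sums_eq {K : AbsRing} {V : NormedModule K}
    (A B : nat -> R) (u : nat -> nat -> V) (v c : nat -> V) (s t : V) :
  ex_series A -> ex_series B ->
  (forall n k, norm (u n k) <= A n * B k)%R ->
  (forall n, is_series (u n) (v n)) -> is_series v s ->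
  (forall k, is_series (fun n => u n k) (c k)) -> is_series c t ->
  s = t.
Proof.
  intros [alpha HA] [beta HB] Hu Hv Hs Hc Ht.
  assert (Hrows := square_sums_lim A B alpha beta u v s HA HB Hu Hv Hs).
  assert (Hcols : filterlim (fun N => sum_n (fun k => sum_n (fun n => u n k) N) N)
                    eventually (locally t)).
  { apply (square_sums_lim B A beta alpha (fun k n => u n k) c t HB HA); [| exact Hc | exact Ht].
    intros k n. rewrite Rmult_comm. apply Hu. }
  refine (filterlim_locally_unique _ _ _ Hrows (filterlim_ext _ _ _ Hcols)).
  intros N. symmetry. apply sum_n_switch.
Qed.

(** Domination by a product of summable sequences provides the row sums and the
    convergence of both iterated series, so only the column sums have to be
    known in advance. *)
Lemma double_series_exchange {K : AbsRing} {V : CompleteNormedModule K}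
    (A B : nat -> R) (u : nat -> nat -> V) (c : nat -> V) :
  ex_series A -> ex_series B ->
  (forall n k, norm (u n k) <= A n * B k)%R ->
  (forall k, is_series (fun n => u n k) (c k)) ->
  exists (v : nat -> V) (s : V),
    (forall n, is_series (u n) (v n)) /\ is_series v s /\ is_series c s.
Proof.
  intros [alpha HA] [beta HB] Hu Hc.
  assert (HuA : forall n, is_series (fun k => A n * B k)%R (A n * beta)%R)
    by (intros n; exact (is_series_scal (V := R_NormedModule) (A n) B beta HB)).
  assert (HuB : forall k, is_series (fun n => A n * B k)%R (alpha * B k)%R).
  { intros k. now apply is_series_scal_r. }
  pose (v := fun n => iota (fun l => is_series (u n) l)).
  assert (Hv : forall n, is_series (u n) (v n)).
  { intros n. destruct (ex_series_le (u n) _ (Hu n) (ex_intro _ _ (HuA n))) as [l Hl].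
    apply (iota_correct (fun l => is_series (u n) l)). exists l. split; [exact Hl |].
    intros l'. now apply is_series_eq. }
  destruct (ex_series_le v (fun n => A n * beta)%R) as [s Hs].
  { intros n. exact (norm_is_series_le _ _ _ _ (Hu n) (Hv n) (HuA n)). }
  { apply ex_series_scal_r. now exists alpha. }
  destruct (ex_series_le c (fun k => alpha * B k)%R) as [t Ht].
  { intros k. exact (norm_is_series_le _ _ _ _ (fun n => Hu n k) (Hc k) (HuB k)). }
  { apply (ex_series_scal (V := R_NormedModule)). now exists beta. }
  exists v, s. split; [exact Hv |]. split; [exact Hs |].
  now rewrite (iterated_sums_eq A B u v c s t (ex_intro _ _ HA) (ex_intro _ _ HB) Hu Hv Hs Hc Ht).
Qed.

Open Scope C_scope.

Lemma double_series_exchange_C (A B : nat -> R) (u : nat -> nat -> C) (c : nat -> C) :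
  ex_series A -> ex_series B ->
  (forall n k, Cmod (u n k) <= A n * B k)%R ->
  (forall k, is_series (fun n => u n k) (c k)) ->
  exists (v : nat -> C) (s : C),
    (forall n, is_series (u n) (v n)) /\ is_series v s /\ is_series c s.
Proof. exact (double_series_exchange (V := C_CompleteNormedModule) A B u c). Qed.

(** * Uniqueness of the coefficients of a power series *)

Lemma pow_n_Cpow (q : C) (n : nat) : pow_n q n = q ^ n.
Proof. induction n as [|n IH]; [reflexivity |]. rewrite Cpow_S, <- IH. reflexivity. Qed.

Lemma is_series_Re_Im (a : nat -> C) (s : C) :
  is_series a s ->
  is_series (fun n => Re (a n)) (Re s) /\ is_series (fun n => Im (a n)) (Im s).
Proof.
  intros Ha.
  assert (Hre : forall N, Re (sum_n a N) = sum_n (fun n => Re (a n)) N).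
  { induction N as [|N IH]; [now rewrite !sum_O |]. rewrite !sum_Sn, <- IH. reflexivity. }
  assert (Him : forall N, Im (sum_n a N) = sum_n (fun n => Im (a n)) N).
  { induction N as [|N IH]; [now rewrite !sum_O |]. rewrite !sum_Sn, <- IH. reflexivity. }
  split.
  - apply (filterlim_ext (fun N => Re (sum_n a N)) _ Hre).
    refine (filterlim_comp _ _ _ (sum_n a) Re _ _ _ Ha _).
    intros P [eps HP]. exists eps. intros y Hy. apply HP, Hy.
  - apply (filterlim_ext (fun N => Im (sum_n a N)) _ Him).
    refine (filterlim_comp _ _ _ (sum_n a) Im _ _ _ Ha _).
    intros P [eps HP]. exists eps. intros y Hy. apply HP, Hy.
Qed.

Lemma is_pseries_Re_Im (a : nat -> C) (r : R) (s : C) :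
  is_pseries a (RtoC r) s ->
  is_pseries (fun n => Re (a n)) r (Re s) /\ is_pseries (fun n => Im (a n)) r (Im s).
Proof.
  intros Ha. apply is_series_Re_Im in Ha. destruct Ha as [Hre Him].
  split; apply is_pseries_R.
  - refine (is_series_ext _ _ _ _ Hre). intros n.
    rewrite pow_n_Cpow, <- RtoC_pow. unfold scal; simpl. unfold Re; simpl.
    unfold mult; simpl. ring.
  - refine (is_series_ext _ _ _ _ Him). intros n.
    rewrite pow_n_Cpow, <- RtoC_pow. unfold scal; simpl. unfold Im; simpl.
    unfold mult; simpl. ring.
Qed.

Lemma real_pseries_coef_unique (a b : nat -> R) (f : R -> R) (rho : R) :
  (0 < rho)%R ->
  (forall r, Rabs r < rho -> is_pseries a r (f r))%R ->
  (forall r, Rabs r < rho -> is_pseries b r (f r))%R ->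
  forall n, a n = b n.
Proof.
  intros Hrho Ha Hb n.
  assert (Hhalf : (Rabs (rho / 2) < rho)%R) by (rewrite Rabs_pos_eq; lra).
  assert (Hcv : forall c : nat -> R,
            (forall r, Rabs r < rho -> is_pseries c r (f r))%R ->
            Rbar_lt 0%R (CV_radius c)).
  { intros c Hc. apply Rbar_not_le_lt. intros Hle.
    apply (CV_disk_outside c (rho / 2)).
    - apply Rbar_le_lt_trans with (1 := Hle). simpl. rewrite Rabs_pos_eq; lra.
    - apply ex_series_lim_0, (proj1 (ex_pseries_R c (rho / 2))).
      exists (f (rho / 2)%R). now apply Hc. }
  apply PSeries_ext_recip; [now apply Hcv | now apply Hcv |].
  exists (mkposreal _ Hrho). intros r Hr.
  assert (Hr' : (Rabs r < rho)%R).
  { change (Rabs (r - 0) < rho)%R in Hr. now rewrite Rminus_0_r in Hr. }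
  now rewrite (is_pseries_unique _ _ _ (Ha r Hr')), (is_pseries_unique _ _ _ (Hb r Hr')).
Qed.

Lemma pseries_coef_unique (a b : nat -> C) (F : C -> C) (rho : R) :
  (0 < rho)%R ->
  (forall q, Cmod q < rho -> is_pseries a q (F q))%R ->
  (forall q, Cmod q < rho -> is_pseries b q (F q))%R ->
  forall n, a n = b n.
Proof.
  intros Hrho Ha Hb n.
  assert (H : forall c : nat -> C, (forall q, Cmod q < rho -> is_pseries c q (F q))%R ->
            forall r, (Rabs r < rho)%R -> is_pseries c (RtoC r) (F (RtoC r))).
  { intros c Hc r Hr. apply Hc. now rewrite Cmod_R. }
  assert (HRe : Re (a n) = Re (b n))
    by exact (real_pseries_coef_unique (fun n => Re (a n)) (fun n => Re (b n))
                (fun r => Re (F (RtoC r))) rho Hrho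
                (fun r Hr => proj1 (is_pseries_Re_Im a r _ (H a Ha r Hr)))
                (fun r Hr => proj1 (is_pseries_Re_Im b r _ (H b Hb r Hr))) n).
  assert (HIm : Im (a n) = Im (b n))
    by exact (real_pseries_coef_unique (fun n => Im (a n)) (fun n => Im (b n))
                (fun r => Im (F (RtoC r))) rho Hrho
                (fun r Hr => proj2 (is_pseries_Re_Im a r _ (H a Ha r Hr)))
                (fun r Hr => proj2 (is_pseries_Re_Im b r _ (H b Hb r Hr))) n).
  now apply injective_projections.
Qed.

(** * Geometric series and finitely supported series *)

Lemma is_series_Cmult (c : C) (a : nat -> C) (l : C) :
  is_series a l -> is_series (fun n => c * a n) (c * l).
Proof. exact (is_series_scal c a l). Qed.

Lemma ex_series_Cmod_le (a : nat -> C) (b : nat -> R) :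
  (forall n, Cmod (a n) <= b n)%R -> ex_series b -> exists l : C, is_series a l.
Proof. exact (ex_series_le (V := C_CompleteNormedModule) a b). Qed.

Lemma ex_series_geom_pos (r : R) : (0 <= r < 1)%R -> ex_series (fun n => r ^ n)%R.
Proof. intros Hr. apply ex_series_geom. rewrite Rabs_pos_eq; lra. Qed.

Lemma ex_series_scal_geom (c r : R) : (0 <= r < 1)%R -> ex_series (fun n => c * r ^ n)%R.
Proof.
  intros Hr. exact (ex_series_scal (V := R_NormedModule) c _ (ex_series_geom_pos r Hr)).
Qed.

(** The Cauchy square of the geometric series has general term [(n + 1) r^n]. *)
Lemma ex_series_arith_geom (r : R) :
  (0 <= r < 1)%R -> ex_series (fun n => INR n * r ^ n)%R.
Proof.
  intros Hr.
  assert (Hg : is_series (fun n => r ^ n)%R (/ (1 - r))%R)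
    by (apply is_series_geom; rewrite Rabs_pos_eq; lra).
  assert (Hpos : forall n, (0 <= r ^ n)%R) by (intros n; apply pow_le; lra).
  apply (ex_series_le (V := R_CompleteNormedModule) _
           (fun n => sum_f_R0 (fun k => r ^ k * r ^ (n - k))%R n)).
  - intros n.
    rewrite (sum_eq _ (fun _ => r ^ n)%R).
    + rewrite sum_cte. change (Rabs (INR n * r ^ n) <= r ^ n * INR (S n))%R.
      rewrite Rabs_pos_eq by (apply Rmult_le_pos; [apply pos_INR | apply Hpos]).
      rewrite (Rmult_comm (r ^ n)). apply Rmult_le_compat_r; [apply Hpos |].
      apply le_INR; lia.
    + intros k Hk. rewrite <- pow_add. f_equal; lia.
  - exists (/ (1 - r) * / (1 - r))%R. now apply is_series_mult_pos.
Qed.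

Lemma one_minus_neq_0 (w : C) : (Cmod w < 1)%R -> 1 - w <> 0.
Proof.
  intros Hw E. assert (E' : w = 1) by (rewrite <- (Cplus_0_l w), <- E; ring).
  rewrite E', Cmod_1 in Hw. lra.
Qed.

Lemma Cmod_inv_one_minus_le (w : C) (r : R) :
  (Cmod w <= r < 1)%R -> (Cmod (/ (1 - w)) <= / (1 - r))%R.
Proof.
  intros Hw. rewrite Cmod_inv by (apply one_minus_neq_0; lra).
  apply Rinv_le_contravar; [lra |].
  assert (H := Cmod_triangle (1 - w) w).
  replace (1 - w + w) with (RtoC 1) in H by ring. rewrite Cmod_1 in H. lra.
Qed.

(** The series converges absolutely, and dropping the first term of its sum [l]
    multiplies it by [w], so [l - 1 = w l]. *)
Lemma is_series_Cgeom (w : C) : (Cmod w < 1)%R -> is_series (fun n => w ^ n) (/ (1 - w)).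
Proof.
  intros Hw.
  destruct (ex_series_Cmod_le (fun n => w ^ n) (fun n => Cmod w ^ n)%R) as [l Hl].
  { intros n. rewrite Cmod_pow. apply Rle_refl. }
  { apply ex_series_geom_pos. split; [apply Cmod_ge_0 | exact Hw]. }
  replace (/ (1 - w)) with l; [exact Hl |].
  assert (E : l - 1 = w * l).
  { apply (is_series_eq (fun n => w ^ S n)).
    - apply is_series_incr_1.
      apply (eq_ind_r (is_series _) Hl). unfold plus; simpl. ring.
    - refine (is_series_ext _ _ _ _ (is_series_Cmult w _ _ Hl)).
      intros n. now rewrite Cpow_S. }
  assert (Hne := one_minus_neq_0 w Hw).
  assert (E' : l * (1 - w) = 1).
  { transitivity (l - w * l); [ring |]. rewrite <- E. ring. }
  transitivity (l * (1 - w) / (1 - w)); [field; exact Hne |].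
  rewrite E'. field. exact Hne.
Qed.

(** Shifting the index turns the sum [l] into [w (l + 1/(1 - w))]. *)
Lemma is_series_arith_Cgeom (w : C) :
  (Cmod w < 1)%R -> is_series (fun n => INR n * w ^ n) (w / ((1 - w) * (1 - w))).
Proof.
  intros Hw.
  destruct (ex_series_Cmod_le (fun n => INR n * w ^ n) (fun n => INR n * Cmod w ^ n)%R)
    as [l Hl].
  { intros n. rewrite Cmod_mult, Cmod_R, Cmod_pow, Rabs_pos_eq by apply pos_INR.
    apply Rle_refl. }
  { apply ex_series_arith_geom. split; [apply Cmod_ge_0 | exact Hw]. }
  replace (w / ((1 - w) * (1 - w))) with l; [exact Hl |].
  assert (Hne := one_minus_neq_0 w Hw).
  assert (E : l = w * (l + / (1 - w))).
  { apply (is_series_eq (fun n => INR (S n) * w ^ S n)).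
    - apply (is_series_incr_1 (fun n => INR n * w ^ n)).
      apply (eq_ind_r (is_series _) Hl). unfold plus; simpl. ring.
    - assert (Hs := is_series_Cmult w _ _ (is_series_plus _ _ _ _ Hl (is_series_Cgeom w Hw))).
      refine (is_series_ext _ _ _ _ Hs).
      intros n. change (w * (INR n * w ^ n + w ^ n) = INR (S n) * w ^ S n).
      rewrite S_INR, RtoC_plus, Cpow_S. ring. }
  assert (E' : l * (1 - w) = w / (1 - w)).
  { transitivity (l - w * l); [ring |]. rewrite E at 1. field. exact Hne. }
  transitivity (l * (1 - w) / (1 - w)); [field; exact Hne |].
  rewrite E'. field. exact Hne.
Qed.

Lemma is_series_finite {K : AbsRing} {V : NormedModule K} (f : nat -> V) (m : nat) :
  (forall n, (m < n)%nat -> f n = zero) -> is_series f (sum_n f m).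
Proof.
  intros Hf. apply (filterlim_ext_loc (fun _ => sum_n f m)); [| apply filterlim_const].
  exists m. intros N HN. induction HN as [|N HN IH]; [reflexivity |].
  rewrite sum_Sn, <- IH, Hf by lia. symmetry. apply plus_zero_r.
Qed.

Lemma is_series_zero {K : AbsRing} {V : NormedModule K} (f : nat -> V) :
  (forall n, f n = zero) -> is_series f zero.
Proof.
  intros Hf. rewrite <- (Hf 0%nat), <- (sum_O f). apply is_series_finite. intros n _. apply Hf.
Qed.

Lemma is_series_drop_zeros {K : AbsRing} {V : NormedModule K} (f : nat -> V) (n : nat) (l : V) :
  (forall k, (k < n)%nat -> f k = zero) -> is_series f l ->
  is_series (fun k => f (n + k)%nat) l.
Proof.
  intros Hf Hl. destruct n as [|n]; [exact Hl |].
  apply is_series_incr_n; [lia |]. simpl pred.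
  replace (sum_n f n) with (zero : V); [now rewrite plus_zero_r |].
  symmetry. transitivity (sum_n (fun _ => zero : V) n).
  - apply sum_n_ext_loc. intros k Hk. apply Hf. lia.
  - induction n as [|n IH]; [apply sum_O |].
    rewrite sum_Sn, IH; [apply plus_zero_r |]. intros k Hk. apply Hf; lia.
Qed.

Lemma minus_minus {K : AbsRing} {V : NormedModule K} (x y : V) : minus x (minus x y) = y.
Proof.
  exact (eq_trans (f_equal (plus x) (opp_minus x y))
           (eq_trans (plus_comm x (minus y x)) (plus_minus_r y x))).
Qed.

Lemma is_series_telescope {K : AbsRing} {V : NormedModule K} (g : nat -> V) (G : V) (m : nat) :
  is_series g G -> is_series (fun n => minus (g n) (g (S m + n)%nat)) (sum_n g m).
Proof.
  intros Hg.
  replace (sum_n g m) with (minus G (minus G (sum_n g m))).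
  - apply (is_series_minus g (fun n => g (S m + n)%nat)); [exact Hg |].
    apply is_series_incr_n; [lia |]. now rewrite plus_minus_r.
  - apply minus_minus.
Qed.

(** The partial sums up to [N] are those of [f] up to [N / d]. *)
Lemma is_series_dilate {K : AbsRing} {V : NormedModule K} (f : nat -> V) (d : nat) (l : V) :
  (0 < d)%nat -> is_series f l ->
  is_series (fun N => if Nat.eqb (N mod d) 0 then f (N / d)%nat else zero) l.
Proof.
  intros Hd Hf.
  apply (filterlim_ext (fun N => sum_n f (N / d)%nat)).
  - induction x as [|N IH].
    + rewrite !sum_O, Nat.Div0.mod_0_l, Nat.Div0.div_0_l, sum_O. reflexivity.
    + rewrite sum_Sn, <- IH.
      assert (HN := Nat.div_mod_eq N d). assert (HSN := Nat.div_mod_eq (S N) d).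
      assert (HNd := Nat.mod_upper_bound N d). assert (HSNd := Nat.mod_upper_bound (S N) d).
      destruct (Nat.eqb_spec (S N mod d) 0) as [E|E].
      * assert (EN : (S N / d = S (N / d))%nat) by nia.
        rewrite EN, sum_Sn. reflexivity.
      * assert (EN : (S N / d = N / d)%nat) by nia.
        rewrite EN. symmetry. apply plus_zero_r.
  - refine (filterlim_comp _ _ _ (fun N => (N / d)%nat) (sum_n f) _ eventually _ _ Hf).
    intros P [M HM]. exists (d * M)%nat. intros N HN. apply HM.
    apply Nat.div_le_lower_bound; lia.
Qed.

Lemma sum_over_divisors_sum_n (N : nat) (f : nat -> C) :
  sum_over_divisors N f =
  sum_n (fun d => if Nat.eqb d 0 then RtoC 0 else if Nat.eqb (N mod d) 0 then f d else RtoC 0) N.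
Proof.
  assert (Hfold : forall l c, fold_right Cplus c l = fold_right Cplus 0 l + c).
  { induction l as [|y l IHl]; intros c; simpl; [ring |]. rewrite (IHl c). ring. }
  assert (Hfilter : forall (p : nat -> bool) (M : nat),
    fold_right Cplus 0 (map f (filter p (seq 1 M))) =
    sum_n (fun d => if Nat.eqb d 0 then RtoC 0 else if p d then f d else RtoC 0) M).
  { intros p. induction M as [|M IH]; [now rewrite sum_O |].
    rewrite seq_S, filter_app, map_app, fold_right_app, sum_Sn, <- IH, Hfold.
    change (1 + M)%nat with (S M).
    apply (f_equal (Cplus _)). simpl. destruct (p (S M)); simpl; ring. }
  exact (Hfilter (fun d => Nat.eqb (N mod d) 0) N).
Qed.

(** * The double sum and its diagonal *)

Lemma CpowZ_opp (x : C) (k : nat) : x <> 0 -> CpowZ x (- Z.of_nat k) = (/ x) ^ k.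
Proof.
  intros Hx. destruct k as [|k]; [reflexivity |].
  rewrite Cpow_inv by exact Hx. simpl Z.of_nat. simpl Z.opp. unfold CpowZ.
  now rewrite SuccNat2Pos.id_succ.
Qed.

Lemma Cmod_mul_pow_S (z q : C) (n : nat) :
  Cmod (z * q ^ S n) = (Cmod (z * q) * Cmod q ^ n)%R.
Proof. rewrite Cpow_S, !Cmod_mult, Cmod_pow. ring. Qed.

Lemma Cmod_mul_pow_S_le (z q : C) (n : nat) :
  (Cmod q < 1)%R -> (Cmod (z * q ^ S n) <= Cmod (z * q))%R.
Proof.
  intros Hq. rewrite Cmod_mul_pow_S.
  rewrite <- (Rmult_1_r (Cmod (z * q))) at 2.
  apply Rmult_le_compat_l; [apply Cmod_ge_0 |].
  rewrite <- (pow1 n). apply pow_incr. split; [apply Cmod_ge_0 | lra].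
Qed.

Lemma one_minus_mul_pow_neq_0 (z q : C) (n : nat) :
  (Cmod q < 1)%R -> (Cmod (z * q) < 1)%R -> 1 - z * q ^ S n <> 0.
Proof.
  intros Hq Hzq. apply one_minus_neq_0.
  now apply Rle_lt_trans with (1 := Cmod_mul_pow_S_le z q n Hq).
Qed.

Lemma one_minus_pow_neq_0 (q : C) (n : nat) : (Cmod q < 1)%R -> 1 - q ^ S n <> 0.
Proof.
  intros Hq. rewrite <- (Cmult_1_l (q ^ S n)).
  apply one_minus_mul_pow_neq_0; now rewrite ?Cmult_1_l.
Qed.

Lemma Cinv_mult_neq_0 (a b : C) : a <> 0 -> b <> 0 -> / (a * b) = / a * / b.
Proof. intros Ha Hb. now field. Qed.

Definition lambert_term (z q : C) (n : nat) : C := z * q ^ S n / (1 - z * q ^ S n).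

Lemma Cmod_inv_le (z q : C) (n : nat) :
  (Cmod q < 1)%R -> (Cmod (z * q) < 1)%R ->
  (Cmod (/ (1 - z * q ^ S n)) <= / (1 - Cmod (z * q)))%R.
Proof.
  intros Hq Hzq. apply Cmod_inv_one_minus_le. split; [now apply Cmod_mul_pow_S_le | exact Hzq].
Qed.

Lemma Cmod_lambert_term_le (z q : C) (n : nat) :
  (Cmod q < 1)%R -> (Cmod (z * q) < 1)%R ->
  (Cmod (lambert_term z q n) <= Cmod (z * q) / (1 - Cmod (z * q)) * Cmod q ^ n)%R.
Proof.
  intros Hq Hzq. unfold lambert_term, Cdiv. rewrite Cmod_mult, Cmod_mul_pow_S.
  apply Rle_trans with (Cmod (z * q) * Cmod q ^ n * / (1 - Cmod (z * q)))%R.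
  - apply Rmult_le_compat_l; [| now apply Cmod_inv_le].
    apply Rmult_le_pos; [apply Cmod_ge_0 | apply pow_le, Cmod_ge_0].
  - apply Req_le. unfold Rdiv. ring.
Qed.

(** The first part of the summand at [(n, n + k)], with [w] for [q / x]. *)
Definition first_part (z q w : C) (n k : nat) : C :=
  w ^ k * (z * q ^ S n) * (/ (1 - z * q ^ S (n + k)) * / (1 - z * q ^ S n)).

(** The second part of the summand at [(n, m)], with [w] for [q / x]. *)
Definition second_part (z q w : C) (n m : nat) : C :=
  w ^ S m / (1 - q ^ S m) * lambert_term z q n.

(** What the power [w ^ S m] contributes to either of the two double sums. *)
Definition column_sum (z q w : C) (m : nat) : C :=
  w ^ S m / (1 - q ^ S m) * sum_n (lambert_term z q) m.

Lemma summand_eq (x z q : C) (n k : nat) : x <> 0 ->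
  (Cmod q < 1)%R -> (Cmod (z * q) < 1)%R ->
  summand x z q n (n + k) = first_part z q (q / x) n k - second_part z q (q / x) n (n + k).
Proof.
  intros Hx Hq Hzq.
  assert (H1 : forall i, 1 - q ^ S i <> 0) by (intros i; now apply one_minus_pow_neq_0).
  assert (H2 : forall i, 1 - z * q ^ S i <> 0)
    by (intros i; now apply one_minus_mul_pow_neq_0).
  unfold summand.
  replace (Z.of_nat n - Z.of_nat (n + k))%Z with (- Z.of_nat k)%Z by lia.
  replace (- Z.of_nat (n + k) - 1)%Z with (- Z.of_nat (S (n + k)))%Z by lia.
  rewrite !CpowZ_opp by exact Hx.
  replace (n + (n + k) + 2)%nat with (S n + S (n + k))%nat by lia.
  replace (n + k + 1)%nat with (S (n + k)) by lia.
  replace (n + 1)%nat with (S n) by lia.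
  unfold first_part, second_part, lambert_term, Cdiv.
  rewrite !Cinv_mult_neq_0, !Cpow_mult_l by auto.
  rewrite (Cpow_add_r q (S n) (S (n + k))).
  replace (q ^ S (n + k)) with (q ^ S n * q ^ k) at 1 by now rewrite <- Cpow_add_r.
  ring.
Qed.

(** Partial fractions: the difference of the two Lambert terms has numerator
    [z q^(n+1) (1 - q^(m+1))], because [t/(1-t) = 1/(1-t) - 1]. This is what makes
    the column sums telescope. *)
Lemma first_part_eq (z q w : C) (n m : nat) :
  (Cmod q < 1)%R -> (Cmod (z * q) < 1)%R ->
  first_part z q w n (S m) =
  w ^ S m / (1 - q ^ S m) * (lambert_term z q n - lambert_term z q (S m + n)).
Proof.
  intros Hq Hzq.
  assert (H1 := one_minus_pow_neq_0 q m Hq).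
  assert (H2 := fun i => one_minus_mul_pow_neq_0 z q i Hq Hzq).
  assert (H3 := H2 n). assert (H4 := H2 (n + S m)%nat).
  unfold first_part, lambert_term. replace (S (S m + n)) with (S n + S m)%nat by lia.
  replace (S (n + S m)) with (S n + S m)%nat in * by lia.
  rewrite Cpow_add_r in *.
  field. auto.
Qed.

(** The columns [k >= 1] telescope to [column_sum], and the column [k = 0] is the
    diagonal series. *)
Lemma first_double_sum (z q w : C) :
  (Cmod w < 1)%R -> (Cmod (z * q) < 1)%R -> (Cmod q < 1)%R ->
  exists (L s : C) (v : nat -> C),
    is_series (fun n => z * q ^ S n / ((1 - z * q ^ S n) * (1 - z * q ^ S n))) L /\
    (forall n, is_series (first_part z q w n) (v n)) /\ is_series v s /\
    is_series (column_sum z q w) (s - L).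
Proof.
  intros Hw Hzq Hq.
  assert (Hw' : (0 <= Cmod w < 1)%R) by (split; [apply Cmod_ge_0 | exact Hw]).
  assert (Hq' : (0 <= Cmod q < 1)%R) by (split; [apply Cmod_ge_0 | exact Hq]).
  pose (K := (Cmod (z * q) * / (1 - Cmod (z * q)) * / (1 - Cmod (z * q)))%R).
  assert (Hle : forall n k,
            (Cmod (first_part z q w n k) <= K * Cmod q ^ n * Cmod w ^ k)%R).
  { intros n k. unfold first_part.
    rewrite (Cmod_mult (w ^ k * _)), (Cmod_mult (w ^ k)), Cmod_mul_pow_S.
    rewrite (Cmod_mult (/ _) (/ _)), Cmod_pow. unfold K.
    apply Rle_trans with
      (Cmod w ^ k * (Cmod (z * q) * Cmod q ^ n) *
       (/ (1 - Cmod (z * q)) * / (1 - Cmod (z * q))))%R.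
    - apply Rmult_le_compat_l.
      + repeat apply Rmult_le_pos; try apply pow_le; apply Cmod_ge_0.
      + apply Rmult_le_compat; try apply Cmod_ge_0; now apply Cmod_inv_le.
    - apply Req_le. ring. }
  destruct (ex_series_Cmod_le (lambert_term z q)
              (fun n => Cmod (z * q) / (1 - Cmod (z * q)) * Cmod q ^ n)%R) as [G HG].
  { intros n. now apply Cmod_lambert_term_le. }
  { now apply ex_series_scal_geom. }
  destruct (ex_series_Cmod_le (fun n => first_part z q w n 0) (fun n => K * Cmod q ^ n)%R)
    as [L HL].
  { intros n. eapply Rle_trans; [apply Hle |]. simpl. lra. }
  { now apply ex_series_scal_geom. }
  destruct (double_series_exchange_C (fun n => K * Cmod q ^ n)%R (fun k => Cmod w ^ k)%R
              (first_part z q w)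
              (fun k => match k with O => L | S m => column_sum z q w m end))
    as [v [s [Hv [Hs Hc]]]].
  { now apply ex_series_scal_geom. }
  { now apply ex_series_geom_pos. }
  { exact Hle. }
  { intros [|m]; [exact HL |].
    apply (is_series_ext (fun n => w ^ S m / (1 - q ^ S m) *
                            (lambert_term z q n - lambert_term z q (S m + n)))).
    - intros n. symmetry. now apply first_part_eq.
    - apply is_series_Cmult. exact (is_series_telescope (lambert_term z q) G m HG). }
  assert (Hdiag : forall n, first_part z q w n 0 =
                    z * q ^ S n / ((1 - z * q ^ S n) * (1 - z * q ^ S n))).
  { intros n. unfold first_part. rewrite Nat.add_0_r.
    assert (Hne := one_minus_mul_pow_neq_0 z q n Hq Hzq).
    simpl (w ^ 0). now field. }
  exists L, s, v. split; [| split; [exact Hv | split; [exact Hs |]]].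
  - exact (is_series_ext _ _ _ Hdiag HL).
  - apply (is_series_incr_1 (fun k => match k with O => L | S m => column_sum z q w m end)).
    apply (eq_ind_r (is_series _) Hc). change (s - L + L = s). ring.
Qed.

(** Extending the summand by 0 to [m < n] makes the index set a product; column
    [m] then has the finitely many terms [n <= m]. *)
Lemma second_double_sum (z q w : C) :
  (Cmod w < 1)%R -> (Cmod (z * q) < 1)%R -> (Cmod q < 1)%R ->
  exists (s : C) (v : nat -> C),
    (forall n, is_series (fun k => second_part z q w n (n + k)) (v n)) /\
    is_series v s /\ is_series (column_sum z q w) s.
Proof.
  intros Hw Hzq Hq.
  assert (Hw' : (0 <= Cmod w < 1)%R) by (split; [apply Cmod_ge_0 | exact Hw]).
  assert (Hq' : (0 <= Cmod q < 1)%R) by (split; [apply Cmod_ge_0 | exact Hq]).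
  destruct (double_series_exchange_C
              (fun n => Cmod (z * q) / (1 - Cmod (z * q)) * Cmod q ^ n)%R
              (fun m => Cmod w * / (1 - Cmod q) * Cmod w ^ m)%R
              (fun n m => if Nat.leb n m then second_part z q w n m else 0)
              (column_sum z q w))
    as [v [s [Hv [Hs Hc]]]].
  { now apply ex_series_scal_geom. }
  { now apply ex_series_scal_geom. }
  { intros n m.
    apply Rle_trans with (Cmod (second_part z q w n m)).
    - destruct (Nat.leb n m); [apply Rle_refl |]. rewrite Cmod_0. apply Cmod_ge_0.
    - unfold second_part, Cdiv. rewrite Cmod_mult, Rmult_comm.
      apply Rmult_le_compat; try apply Cmod_ge_0; [now apply Cmod_lambert_term_le |].
      rewrite Cmod_mult, Cmod_pow.
      apply Rle_trans with (Cmod w ^ S m * / (1 - Cmod q))%R.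
      + apply Rmult_le_compat_l; [apply pow_le; lra |].
        assert (Hinv := Cmod_inv_le 1 q m Hq). rewrite !Cmult_1_l in Hinv.
        exact (Hinv Hq).
      + apply Req_le. simpl. ring. }
  { intros m. unfold column_sum.
    replace (w ^ S m / (1 - q ^ S m) * sum_n (lambert_term z q) m) with
      (sum_n (fun n => if Nat.leb n m then second_part z q w n m else RtoC 0) m).
    - apply (is_series_finite
               (fun n => if Nat.leb n m then second_part z q w n m else RtoC 0)).
      intros n Hn. now rewrite (proj2 (Nat.leb_gt n m) Hn).
    - rewrite <- (sum_n_mult_l (K := C_Ring)). apply sum_n_ext_loc.
      intros n Hn. now rewrite (proj2 (Nat.leb_le n m) Hn). }
  exists s, v. split; [| now split].
  intros n. refine (is_series_ext _ _ _ _ (is_series_drop_zeros _ n _ _ (Hv n))).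
  - intros k. simpl. now rewrite (proj2 (Nat.leb_le n (n + k)) ltac:(lia)).
  - intros k Hk. simpl. now rewrite (proj2 (Nat.leb_gt n k) Hk).
Qed.

(** Grouped by powers of [w], the two double sums differ only by the diagonal. *)
Lemma double_sum_diagonal (x z q : C) : x <> 0 -> conv_disc x z q ->
  exists L : C,
    is_series (fun n => z * q ^ S n / ((1 - z * q ^ S n) * (1 - z * q ^ S n))) L /\
    is_double_sum (summand x z q) L.
Proof.
  intros Hx [Hqx [Hzq Hq]].
  assert (Hw : (Cmod (q / x) < 1)%R).
  { rewrite Cmod_div by exact Hx. apply Rlt_div_l; [now apply Cmod_gt_0 | lra]. }
  destruct (first_double_sum z q (q / x) Hw Hzq Hq) as [L [s1 [v1 [HL [Hv1 [Hs1 Hc1]]]]]].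
  destruct (second_double_sum z q (q / x) Hw Hzq Hq) as [s2 [v2 [Hv2 [Hs2 Hc2]]]].
  assert (Es : s2 = s1 - L) by exact (is_series_eq _ _ _ Hc2 Hc1).
  exists L. split; [exact HL |].
  exists (fun n => v1 n - v2 n). split.
  - intros n.
    apply (is_series_ext (fun k => first_part z q (q / x) n k
                                   - second_part z q (q / x) n (n + k))).
    { intros k. symmetry. now apply summand_eq. }
    exact (is_series_minus _ _ _ _ (Hv1 n) (Hv2 n)).
  - replace L with (s1 - s2) by (rewrite Es; ring).
    exact (is_series_minus v1 v2 _ _ Hs1 Hs2).
Qed.

(** * The diagonal as a power series *)

Lemma Cmod_term (z q : C) (d N : nat) : (d <= N)%nat ->
  Cmod (INR d * z ^ d * q ^ N) = (INR d * Cmod (z * q) ^ d * Cmod q ^ (N - d))%R.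
Proof.
  intros HdN. replace N with (d + (N - d))%nat at 1 by lia.
  rewrite Cpow_add_r, !Cmod_mult, Cmod_R, !Cmod_pow, Rpow_mult_distr,
    Rabs_pos_eq by apply pos_INR. ring.
Qed.

(** Expand [t / (1 - t)^2 = sum_d d t^d] at [t = z q^(k+1)] and sum over [k] first. *)
Lemma diagonal_double_sum (z q L : C) :
  (Cmod (z * q) < 1)%R -> (Cmod q < 1)%R ->
  is_series (fun n => z * q ^ S n / ((1 - z * q ^ S n) * (1 - z * q ^ S n))) L ->
  exists v : nat -> C,
    (forall d, is_series (fun k => INR d * z ^ d * q ^ (d * S k)) (v d)) /\ is_series v L.
Proof.
  intros Hzq Hq HL.
  assert (Hq0 := Cmod_ge_0 q). assert (Hzq0 := Cmod_ge_0 (z * q)).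
  destruct (double_series_exchange_C (fun d => INR d * Cmod (z * q) ^ d)%R
              (fun k => Cmod q ^ k)%R
              (fun d k => INR d * z ^ d * q ^ (d * S k))
              (fun n => z * q ^ S n / ((1 - z * q ^ S n) * (1 - z * q ^ S n))))
    as [v [s [Hv [Hs Hs']]]].
  { apply ex_series_arith_geom. lra. }
  { apply ex_series_geom_pos. lra. }
  { intros d k. destruct d as [|d].
    { simpl. rewrite !Cmult_0_l, Cmod_0. lra. }
    rewrite Cmod_term by nia. apply Rmult_le_compat_l.
    { apply Rmult_le_pos; [apply pos_INR | apply pow_le; lra]. }
    replace (S d * S k - S d)%nat with (k + d * k)%nat by nia.
    rewrite pow_add. rewrite <- (Rmult_1_r (Cmod q ^ k)) at 2.
    apply Rmult_le_compat_l; [apply pow_le; lra |].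
    rewrite <- (pow1 (d * k)). apply pow_incr. lra. }
  { intros k.
    refine (is_series_ext _ _ _ _ (is_series_arith_Cgeom (z * q ^ S k) _)).
    - intros d. now rewrite Cpow_mult_l, <- Cpow_mult_r, (Nat.mul_comm (S k)), Cmult_assoc.
    - apply Rle_lt_trans with (2 := Hzq). now apply Cmod_mul_pow_S_le. }
  exists v. split; [exact Hv |].
  now rewrite <- (is_series_eq _ _ _ Hs' HL).
Qed.

(** The row [N = 0] is set to 0: every [d] divides 0, and the terms [d z^d]
    are not summable when [|z| >= 1]. *)
Definition divisor_term (z q : C) (N d : nat) : C :=
  if Nat.eqb d 0 then 0
  else if Nat.eqb (N mod d) 0 then
         (if Nat.eqb N 0 then 0 else INR d * z ^ d * q ^ N)
       else 0.

(** If [r] bounds [|z q|] and [|q|], and [d <= N], then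
    [|z^d q^N| = |z q|^d |q|^(N-d) <= r^N <= t^(2N) <= t^N t^d]. Passing from [r]
    to [t] with [r <= t^2] is what splits the bound into a product. *)
Lemma Cmod_divisor_term_le (z q : C) (r t : R) (N d : nat) :
  (Cmod (z * q) <= r)%R -> (Cmod q <= r)%R -> (r <= t * t)%R -> (0 <= t < 1)%R ->
  (Cmod (divisor_term z q N d) <= t ^ N * (INR d * t ^ d))%R.
Proof.
  intros Hzq Hq Hrt Ht.
  assert (Hq0 := Cmod_ge_0 q). assert (Hzq0 := Cmod_ge_0 (z * q)).
  assert (Hpos : (0 <= t ^ N * (INR d * t ^ d))%R).
  { apply Rmult_le_pos; [apply pow_le; lra |].
    apply Rmult_le_pos; [apply pos_INR | apply pow_le; lra]. }
  unfold divisor_term.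
  destruct (Nat.eqb_spec d 0) as [Hd|Hd]; [now rewrite Cmod_0 |].
  destruct (Nat.eqb_spec (N mod d) 0) as [HNd|HNd]; [| now rewrite Cmod_0].
  destruct (Nat.eqb_spec N 0) as [HN|HN]; [now rewrite Cmod_0 |].
  assert (HdN : (d <= N)%nat).
  { apply Nat.Div0.mod_divides in HNd. destruct HNd as [c Hc]. destruct c; nia. }
  rewrite Cmod_term by exact HdN.
  rewrite (Rmult_comm (t ^ N)), !Rmult_assoc.
  apply Rmult_le_compat_l; [apply pos_INR |].
  apply Rle_trans with (r ^ d * r ^ (N - d))%R.
  { apply Rmult_le_compat; try (apply pow_le; lra); apply pow_incr; lra. }
  rewrite <- !pow_add. replace (d + (N - d))%nat with N by lia.
  apply Rle_trans with ((t * t) ^ N)%R; [apply pow_incr; lra |].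
  rewrite Rpow_mult_distr, <- pow_add.
  replace (N + N)%nat with ((d + N) + (N - d))%nat by lia.
  rewrite (pow_add _ (d + N)). rewrite <- (Rmult_1_r (t ^ (d + N))) at 2.
  apply Rmult_le_compat_l; [apply pow_le; lra |].
  rewrite <- (pow1 (N - d)). apply pow_incr. lra.
Qed.

(** The nonzero terms sit at the multiples [N = d (k + 1)]. *)
Lemma is_series_divisor_term_multiples (z q l : C) (d : nat) :
  is_series (fun k => INR d * z ^ d * q ^ (d * S k)) l ->
  is_series (fun N => divisor_term z q N d) l.
Proof.
  intros Hl. destruct d as [|d].
  - assert (E : l = 0).
    { apply (is_series_eq _ _ _ Hl). apply (is_series_zero (V := C_NormedModule)).
      intros k. simpl. now rewrite !Cmult_0_l. }
    rewrite E. now apply (is_series_zero (V := C_NormedModule)).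
  - pose (f := fun j => if Nat.eqb j 0 then RtoC 0 else INR (S d) * z ^ S d * q ^ (S d * j)).
    assert (Hf : is_series f l).
    { apply is_series_decr_1. apply (eq_ind_r (is_series _) Hl).
      change (l + - 0 = l). ring. }
    refine (is_series_ext _ _ _ _ (is_series_dilate f (S d) _ _ Hf)); [| lia].
    intros N. unfold divisor_term, f. simpl (Nat.eqb (S d) 0). cbv iota.
    destruct (Nat.eqb_spec (N mod S d) 0) as [HNd|HNd]; [| reflexivity].
    assert (HN : N = (S d * (N / S d))%nat).
    { assert (H := Nat.div_mod_eq N (S d)). lia. }
    rewrite <- HN.
    destruct (Nat.eqb_spec N 0), (Nat.eqb_spec (N / S d) 0); try reflexivity; nia.
Qed.

Lemma is_series_divisor_term_divisors (z q : C) (N : nat) :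
  is_series (divisor_term z q N)
    (q ^ N * sum_over_divisors N (fun d => INR d * z ^ d)).
Proof.
  rewrite sum_over_divisors_sum_n.
  replace (q ^ N * _) with (sum_n (divisor_term z q N) N).
  - apply (is_series_finite (V := C_NormedModule) (divisor_term z q N)).
    intros d Hd. unfold divisor_term.
    destruct (Nat.eqb_spec d 0) as [_|_]; [reflexivity |].
    rewrite Nat.mod_small by exact Hd.
    now destruct (Nat.eqb_spec N 0).
  - rewrite <- (sum_n_mult_l (K := C_Ring)). apply sum_n_ext_loc. intros d Hd.
    unfold divisor_term, mult; simpl.
    destruct (Nat.eqb_spec d 0) as [_|Hd0]; [ring |].
    destruct (Nat.eqb_spec (N mod d) 0) as [_|_]; [| ring].
    destruct (Nat.eqb_spec N 0) as [HN|_]; [lia | ring].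
Qed.

Lemma lambert_pseries (z q L : C) :
  (Cmod (z * q) < 1)%R -> (Cmod q < 1)%R ->
  is_series (fun n => z * q ^ S n / ((1 - z * q ^ S n) * (1 - z * q ^ S n))) L ->
  is_pseries (fun N => sum_over_divisors N (fun d => INR d * z ^ d)) q L.
Proof.
  intros Hzq Hq HL.
  destruct (diagonal_double_sum z q L Hzq Hq HL) as [v [Hv Hs]].
  assert (Hq0 := Cmod_ge_0 q).
  pose (r := Rmax (Cmod (z * q)) (Cmod q)).
  assert (Hr1 : (Cmod (z * q) <= r)%R) by apply Rmax_l.
  assert (Hr2 : (Cmod q <= r)%R) by apply Rmax_r.
  assert (Hr : (r < 1)%R) by now apply Rmax_lub_lt.
  (* [r <= t^2] is the inequality between the geometric and arithmetic means of 1 and [r]. *)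
  pose (t := ((1 + r) / 2)%R).
  assert (Ht : (0 <= t < 1)%R) by (unfold t; lra).
  assert (Hrt : (r <= t * t)%R) by (unfold t; nra).
  destruct (double_series_exchange_C (fun N => t ^ N)%R (fun d => INR d * t ^ d)%R
              (divisor_term z q) v)
    as [v' [s [Hv' [Hs' Hs'']]]].
  { now apply ex_series_geom_pos. }
  { now apply ex_series_arith_geom. }
  { intros N d. now apply (Cmod_divisor_term_le z q r). }
  { intros d. now apply is_series_divisor_term_multiples. }
  rewrite <- (is_series_eq _ _ _ Hs'' Hs).
  refine (is_series_ext _ _ _ _ Hs'). intros N.
  rewrite pow_n_Cpow.
  exact (is_series_eq _ _ _ (Hv' N) (is_series_divisor_term_divisors z q N)).
Qed.

Lemma double_sum_pseries (x z q : C) : x <> 0 -> conv_disc x z q ->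
  exists s : C, is_double_sum (summand x z q) s /\
    is_pseries (fun N => sum_over_divisors N (fun d => INR d * z ^ d)) q s.
Proof.
  intros Hx Hq. destruct (double_sum_diagonal x z q Hx Hq) as [L [HL Hsum]].
  destruct Hq as [_ [Hzq Hq]].
  exists L. split; [exact Hsum | now apply lambert_pseries].
Qed.

(** * Coefficients of the double sum *)

Lemma is_double_sum_unique (u : nat -> nat -> C) (s t : C) :
  is_double_sum u s -> is_double_sum u t -> s = t.
Proof.
  intros [v [Hv Hs]] [v' [Hv' Ht]].
  apply (is_series_eq v _ _ Hs).
  refine (is_series_ext _ _ _ _ Ht). intros n. exact (is_series_eq _ _ _ (Hv' n) (Hv n)).
Qed.

Lemma conv_disc_ball (x z : C) : x <> 0 ->
  exists rho : R, (0 < rho)%R /\ forall q, (Cmod q < rho)%R -> conv_disc x z q.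
Proof.
  intros Hx. assert (Hx' := proj1 (Cmod_gt_0 x) Hx). assert (Hz := Cmod_ge_0 z).
  assert (Hi : (0 < / (1 + Cmod z))%R) by (apply Rinv_0_lt_compat; lra).
  exists (Rmin (Cmod x) (/ (1 + Cmod z))). split; [now apply Rmin_glb_lt |].
  intros q Hq.
  assert (Hq1 := Rlt_le_trans _ _ _ Hq (Rmin_l _ _)).
  assert (Hq2 := Rlt_le_trans _ _ _ Hq (Rmin_r _ _)).
  assert (Hq3 : ((1 + Cmod z) * Cmod q < 1)%R).
  { replace 1%R with ((1 + Cmod z) * / (1 + Cmod z))%R at 2 by (field; lra).
    apply Rmult_lt_compat_l; lra. }
  assert (Hq0 := Cmod_ge_0 q).
  split; [exact Hq1 |]. rewrite Cmod_mult. split; nra.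
Qed.

Theorem corollary3p7 (x z : C) (hx : x <> 0) :
  (forall q : C, conv_disc x z q ->
     exists s : C, is_double_sum (summand x z q) s) /\
  (forall F : C -> C,
     (forall q : C, conv_disc x z q -> is_double_sum (summand x z q) (F q)) ->
     forall N : nat, (0 < N)%nat ->
       is_coef (conv_disc x z) F N
         (sum_over_divisors N (fun d : nat => INR d * z ^ d))).
Proof.
  split.
  - intros q Hq. destruct (double_sum_pseries x z q hx Hq) as [s [Hs _]]. now exists s.
  - intros F HF N _.
    pose (sigma := fun M => sum_over_divisors M (fun d : nat => INR d * z ^ d)).
    assert (Hsigma : is_expansion (conv_disc x z) F sigma).
    { intros q Hq. destruct (double_sum_pseries x z q hx Hq) as [s [Hs Hps]].
      now rewrite (is_double_sum_unique _ _ _ (HF q Hq) Hs). }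
    split; [now exists sigma |].
    intros a Ha. destruct (conv_disc_ball x z hx) as [rho [Hrho Hball]].
    apply (pseries_coef_unique a sigma F rho Hrho); intros q Hq; [apply Ha | apply Hsigma];
      now apply Hball.
Qed.
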